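(* Let $k$ be a field, $n>0$, and let $R=k\langle x_0,\dots,x_n\rangle$ be the free $k$-algebra. Let $R_{fc}$ be the localization of $R$ with respect to the Gabriel topology of right ideals of finite codimension, and let $Q=R_\Sigma$ be the universal localization of $R$ with respect to the family $\Sigma$ of all monomorphisms between finitely generated projective right $R$-modules whose images have finite codimension. Then $R_{fc}\cong Q$ as $k$-algebras.
   Context: Codimension means $k$-dimension of the quotient. $\mathcal{F}_{fc}$ is the Gabriel topology on $R$ whose basic neighborhoods of $0$ are the right ideals of finite codimension. For a right $R$-module $M$, $M_{fc}=\varinjlim_{I\in\mathcal{F}_{fc}}\operatorname{Hom}_R(I,M)$, the direct limit being taken over restriction maps. $R_{fc}$ is a ring: for $f\in\operatorname{Hom}_R(I,R)$ and $g\in\operatorname{Hom}_R(J,R)$, the product $[f][g]$ is the class of the composite $fg$ restricted to $g^{-1}(I)$, which again has finite codimension. The universal localization $R\to R_\Sigma$ is the universal ring homomorphism from $R$ such that every map $s\otimes_R 1_{R_\Sigma}$ with $s\in\Sigma$ is invertible. *)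

(* Defs.v *)
From HB Require Import structures.
From mathcomp Require Import all_boot all_algebra.
From mathcomp Require Import boolp classical_sets.
From mathcomp Require Import monalg.

Set Implicit Arguments.
Unset Strict Implicit.
Unset Printing Implicit Defensive.

Import GRing.Theory.

Local Open Scope ring_scope.
Local Open Scope quotient_scope.

(* Right modules over R are left modules over the converse ring R^c; the
   right action v.r is written (r : R^c) *: v. *)

(* V/W is a finite-dimensional k-space: it is spanned by the classes of
   finitely many vectors of V. *)
Definition finite_codim (k : fieldType) (V : lmodType k) (W : set V) : Prop :=
  exists (d : nat) (b : 'I_d -> V), forall v : V,
    exists c : 'I_d -> k, W (v - \sum_i c i *: b i).

Lemma zmod_cancel (V : zmodType) (v x y a b : V) :
  v - (x + a) - (y - (x + b)) = v - y - (a - b).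
Proof.
rewrite !opprB -!addrA; congr (_ + _).
by rewrite opprD addrACA addNr add0r addrC -addrA addrCA.
Qed.

Section LinearSubsets.
Variables (k : fieldType) (V : lmodType k).

Definition lin_closed (W : set V) : Prop :=
  W 0 /\ forall (c : k) (u v : V), W u -> W v -> W (c *: u + v).

Lemma lin_closedB (W : set V) u v : lin_closed W -> W u -> W v -> W (u - v).
Proof.
by move=> [_ W1] Wu Wv; rewrite -scaleN1r addrC; apply: W1.
Qed.

Lemma lin_closedZ (W : set V) c u : lin_closed W -> W u -> W (c *: u).
Proof. by move=> [W0 W1] Wu; rewrite -[_ *: _]addr0; apply: W1. Qed.

Lemma lin_closedD (W : set V) u v : lin_closed W -> W u -> W v -> W (u + v).
Proof. by move=> [W0 W1] Wu Wv; rewrite -[u]scale1r; apply: W1. Qed.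

Lemma lin_closed_sum (W : set V) d (c : 'I_d -> k) (b : 'I_d -> V) :
  lin_closed W -> (forall i, W (b i)) -> W (\sum_i c i *: b i).
Proof.
move=> Wl Wb; elim/big_ind: _ => [|x y|i _]; first by case: Wl.
  exact: lin_closedD.
exact: lin_closedZ.
Qed.

Lemma span_sub (W : set V) d (b : 'I_d -> V) (U : set V) :
  lin_closed W -> lin_closed U ->
  (forall v, U v -> exists c : 'I_d -> k, W (v - \sum_i c i *: b i)) ->
  exists (e : nat) (u : 'I_e -> V), (forall i, U (u i)) /\
    forall v, U v -> exists c : 'I_e -> k, W (v - \sum_i c i *: u i).
Proof.
move=> Wl; elim: d b U => [|d IH] b U Ul spanU.
  exists 0%N, (fun _ => 0); split=> [[]//|v /spanU[c]].
  by rewrite big_ord0 => Wv; exists (fun _ => 0); rewrite big_ord0.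
pose U' : set V := fun v => U v /\
  exists c : 'I_d -> k, W (v - \sum_i c i *: b (lift ord0 i)).
have U'l : lin_closed U'.
  split.
    split; first by case: Ul.
    exists (fun _ => 0); rewrite big1 ?subr0; first by case: Wl.
    by move=> i _; rewrite scale0r.
  move=> a u v [Uu [c Wu]] [Uv [c' Wv]]; split; first by case: Ul => _; apply.
  exists (fun i => a * c i + c' i).
  have -> : a *: u + v - \sum_i (a * c i + c' i) *: b (lift ord0 i) =
     a *: (u - \sum_i c i *: b (lift ord0 i)) +
       (v - \sum_i c' i *: b (lift ord0 i)).
    rewrite scalerBr scaler_sumr addrACA -opprD -big_split /=.
    by congr (_ - _); apply: eq_bigr => i _; rewrite scalerDl scalerA.
  by case: Wl => _; apply.
have [|e [u [U'u spanU']]] := IH (b \o lift ord0) U' U'l.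
  by move=> v [].
have [[w [Uw [c [Wc c0]]]]|noU] := pselect (exists w, U w /\
    exists c : 'I_d.+1 -> k, W (w - \sum_i c i *: b i) /\ c ord0 != 0).
  exists e.+1, (fun i => oapp u w (unlift ord0 i)); split.
    by move=> i; case: unliftP => [j _|_] //=; case: (U'u j).
  move=> v Uv; have [c' Wc'] := spanU _ Uv.
  have /spanU'[c'' Wc''] : U' (v - (c' ord0 / c ord0) *: w).
    split; first by apply: (lin_closedB Ul) => //; apply: lin_closedZ.
    exists (fun i => c' (lift ord0 i) - c' ord0 / c ord0 * c (lift ord0 i)).
    have := lin_closedB Wl Wc' (lin_closedZ (c' ord0 / c ord0) Wl Wc).
    under [in X in _ -> X]eq_bigr do rewrite scalerBl -scalerA.
    rewrite sumrB -scaler_sumr !big_ord_recl scalerBr scalerDr scalerA divfK //.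
    by rewrite zmod_cancel.
  exists (fun i => oapp c'' (c' ord0 / c ord0) (unlift ord0 i)).
  rewrite big_ord_recl unlift_none /= opprD addrA.
  by under eq_bigr do rewrite !liftK /=.
exists e, u; split=> [i|v Uv]; first by case: (U'u i).
apply: spanU'; split=> //; have [c Wc] := spanU _ Uv.
exists (fun i => c (lift ord0 i)); have [c0|c0] := eqVneq (c ord0) 0.
  by move: Wc; rewrite big_ord_recl c0 scale0r add0r.
by case: noU; exists v; split=> //; exists c.
Qed.
End LinearSubsets.

Section FiniteCodimensionIdeals.
Variables (k : fieldType) (A : algType k).

Definition right_ideal (I : set A) : Prop :=
  [/\ I 0, forall a b, I a -> I b -> I (a + b)
    & forall a r, I a -> I (a * r)].

Definition fc_ideal (I : set A) : Prop := right_ideal I /\ finite_codim I.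

Lemma fc_ideal_lin I : fc_ideal I -> lin_closed I.
Proof.
move=> [[I0 ID IM] _]; split=> // c u v Iu Iv.
by apply: ID => //; rewrite -mulr_algr; apply: IM.
Qed.

Lemma fc_idealT : fc_ideal setT.
Proof. by split; [split|exists 0%N, (fun _ => 0) => v; exists (fun _ => 0)]. Qed.

Lemma fc_ideal_preim (J I : set A) (g : A -> A) :
    fc_ideal J -> fc_ideal I ->
    (forall a b, J a -> J b -> g (a + b) = g a + g b) ->
    (forall a r, J a -> g (a * r) = g a * r) ->
  fc_ideal [set a | J a /\ I (g a)].
Proof.
move=> fJ fI gD gM; have Jl := fc_ideal_lin fJ; have Il := fc_ideal_lin fI.
have [[J0 JD JM] [d [b spanJ]]] := fJ; have [[I0 ID IM] [e [c spanI]]] := fI.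
have g0 : g 0 = 0 by have := gM 0 0 J0; rewrite !mulr0.
have gZ x a : J a -> g (x *: a) = x *: g a.
  by move=> Ja; rewrite -[x *: a]mulr_algr gM // mulr_algr.
have gB a a' : J a -> J a' -> g (a - a') = g a - g a'.
  move=> Ja Ja'; rewrite -[- a']scaleN1r gD ?gZ ?scaleN1r //.
  by rewrite -scaleN1r; apply: (lin_closedZ _ Jl).
have gS n (x : 'I_n -> k) (a : 'I_n -> A) : (forall i, J (a i)) ->
    g (\sum_i x i *: a i) = \sum_i x i *: g (a i).
  move=> Ja; suff [] : J (\sum_i x i *: a i) /\
    g (\sum_i x i *: a i) = \sum_i x i *: g (a i) by [].
  elim/big_ind2: _ => [//|s1 s2 t1 t2 [Js <-] [Jt <-]|i _].
    by split; [apply: JD|rewrite gD].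
  by split; [apply: (lin_closedZ _ Jl)|rewrite gZ].
have Ul : lin_closed [set y | exists2 a, J a & y = g a].
  split; first by exists 0.
  move=> x _ _ [a Ja ->] [a' Ja' ->]; exists (x *: a + a').
    by case: Jl => _; apply.
  by rewrite gD ?gZ //; apply: (lin_closedZ _ Jl).
have [|f [u [Uu spanU]]] := span_sub Il Ul (b := c).
  by move=> v _; apply: spanI.
have /choice[a Ja] : forall i, exists a, J a /\ u i = g a.
  by move=> i; have [a] := Uu i; exists a.
have Ja1 i : J (a i) by case: (Ja i).
split.
  split; first by rewrite /= g0.
    by move=> x y [Jx Ix] [Jy Iy]; split; [apply: JD|rewrite gD //; apply: ID].
  by move=> x r [Jx Ix]; split; [apply: JM|rewrite gM //; apply: IM].
exists (d + f)%N, (fun i => match split i with inl i => b i | inr i => a i end).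
move=> v; have [x Jx] := spanJ v.
have [|y Iy] := spanU (g (v - \sum_i x i *: b i)).
  by exists (v - \sum_i x i *: b i).
exists (fun i => match split i with inl i => x i | inr i => y i end).
rewrite big_split_ord /= opprD addrA.
under eq_bigr do rewrite -[lshift _ _]/(unsplit (inl _)) unsplitK.
under [in X in _ - _ - X]eq_bigr
  do rewrite -[rshift _ _]/(unsplit (inr _)) unsplitK.
have Js : J (\sum_i y i *: a i) by exact: (lin_closed_sum _ Jl).
split; first exact: (lin_closedB Jl).
rewrite gB // gS //; move: Iy; congr I; congr (_ - _).
by apply: eq_bigr => i _; have [_ <-] := Ja i.
Qed.

Lemma fc_idealI (J I : set A) :
  fc_ideal J -> fc_ideal I -> fc_ideal (J `&` I)%classic.
Proof. by move=> fJ fI; apply: (@fc_ideal_preim J I id). Qed.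

End FiniteCodimensionIdeals.

(* An element of Hom_R(I, R) with I of finite codimension; only the values of
   hom on I matter, the others being forgotten in the direct limit. *)
Record fc_hom (k : fieldType) (A : algType k) := FcHom {
  dom : set A;
  hom : A -> A;
  dom_fc : fc_ideal dom;
  homD : forall a b, dom a -> dom b -> hom (a + b) = hom a + hom b;
  homM : forall a r, dom a -> hom (a * r) = hom a * r
}.

HB.instance Definition _ (k : fieldType) (A : algType k) :=
  gen_eqMixin (fc_hom A).
HB.instance Definition _ (k : fieldType) (A : algType k) :=
  gen_choiceMixin (fc_hom A).

Section Localization.
Variables (k : fieldType) (A : algType k).
Implicit Types f g h : fc_hom A.

(* Equality in the direct limit: agreement after restriction to some right
   ideal of finite codimension. *)
Definition germ_eq f g : Prop := exists I : set A,
  [/\ fc_ideal I, (I `<=` dom f `&` dom g)%classic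
    & forall a, I a -> hom f a = hom g a].

Definition germ_eqb f g : bool := `[< germ_eq f g >].

Lemma germ_eq_refl : reflexive germ_eqb.
Proof.
by move=> f; apply/asboolP; exists (dom f); split=> //; apply: dom_fc.
Qed.

Lemma germ_eq_sym : symmetric germ_eqb.
Proof.
suff S f g : germ_eq f g -> germ_eq g f.
  by move=> f g; apply: asbool_equiv_eq; split; apply: S.
by move=> [I [fI sI eqI]]; exists I; split=> // [a /sI[]//|a /eqI].
Qed.

Lemma germ_eq_trans : transitive germ_eqb.
Proof.
move=> g f h /asboolP[I [fI sI eqI]] /asboolP[J [fJ sJ eqJ]]; apply/asboolP.
exists (I `&` J)%classic; split; first exact: fc_idealI.
  by move=> a [/sI[fa _] /sJ[_ ha]].
by move=> a [Ia Ja]; rewrite eqI // eqJ.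
Qed.

Canonical germ_equiv := EquivRel germ_eqb germ_eq_refl germ_eq_sym germ_eq_trans.

(* The ring R_fc, with R = A *)
Definition fc_loc : Type := {eq_quot germ_equiv}.
HB.instance Definition _ := Choice.on fc_loc.
HB.instance Definition _ := EqQuotient.on fc_loc.

Lemma germP f g : germ_eq f g <-> \pi_fc_loc f = \pi_fc_loc g.
Proof.
by split=> [E|/eqquotP/asboolP//]; apply/eqquotP/asboolP.
Qed.

#[local] Obligation Tactic := idtac.

Program Definition fch_zero : fc_hom A := @FcHom k A setT (fun=> 0) _ _ _.
Next Obligation. exact: fc_idealT. Qed.
Next Obligation. by move=> * /=; rewrite addr0. Qed.
Next Obligation. by move=> * /=; rewrite mul0r. Qed.

Program Definition fch_one : fc_hom A := @FcHom k A setT id _ _ _.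
Next Obligation. exact: fc_idealT. Qed.
Next Obligation. by []. Qed.
Next Obligation. by []. Qed.

Program Definition fch_opp f : fc_hom A :=
  @FcHom k A (dom f) (fun a => - hom f a) _ _ _.
Next Obligation. by move=> *; apply: dom_fc. Qed.
Next Obligation. by move=> f a b fa fb; rewrite /= homD // opprD. Qed.
Next Obligation. by move=> f a r fa; rewrite /= homM // mulNr. Qed.

Program Definition fch_add f g : fc_hom A :=
  @FcHom k A (dom f `&` dom g)%classic (fun a => hom f a + hom g a) _ _ _.
Next Obligation. by move=> f g; apply: fc_idealI; apply: dom_fc. Qed.
Next Obligation. by move=> f g a b [? ?] [? ?]; rewrite /= !homD // addrACA. Qed.
Next Obligation. by move=> f g a r [? ?]; rewrite /= !homM // mulrDl. Qed.

Program Definition fch_scale (c : k) f : fc_hom A :=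
  @FcHom k A (dom f) (fun a => c *: hom f a) _ _ _.
Next Obligation. by move=> *; apply: dom_fc. Qed.
Next Obligation. by move=> c f a b fa fb; rewrite /= homD // scalerDr. Qed.
Next Obligation. by move=> c f a r fa; rewrite /= homM // scalerAl. Qed.

Program Definition fch_mul f g : fc_hom A :=
  @FcHom k A [set a | dom g a /\ dom f (hom g a)] (fun a => hom f (hom g a))
    _ _ _.
Next Obligation.
by move=> f g; apply: fc_ideal_preim;
  [exact: dom_fc|exact: dom_fc|exact: homD|exact: homM].
Qed.
Next Obligation. by move=> f g a b [? ?] [? ?]; rewrite /= !homD. Qed.
Next Obligation. by move=> f g a r [? ?]; rewrite /= !homM. Qed.

Lemma germ_pw (I : set A) f g : fc_ideal I ->
  (forall a, I a -> [/\ dom f a, dom g a & hom f a = hom g a]) -> germ_eq f g.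
Proof.
move=> fI E; exists I; split=> // [a /E[]//|a /E[] //].
Qed.

Definition loc_zero : fc_loc := \pi_fc_loc fch_zero.
Definition loc_one : fc_loc := \pi_fc_loc fch_one.
Definition loc_opp (u : fc_loc) : fc_loc := \pi_fc_loc (fch_opp (repr u)).
Definition loc_add (u v : fc_loc) : fc_loc := \pi_fc_loc (fch_add (repr u) (repr v)).
Definition loc_scale (c : k) (u : fc_loc) : fc_loc :=
  \pi_fc_loc (fch_scale c (repr u)).
Definition loc_mul (u v : fc_loc) : fc_loc := \pi_fc_loc (fch_mul (repr u) (repr v)).

Lemma germ_repr f : germ_eq (repr (\pi_fc_loc f)) f.
Proof. by apply/germP; rewrite reprK. Qed.

Lemma loc_oppE f : loc_opp (\pi_fc_loc f) = \pi_fc_loc (fch_opp f).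
Proof.
apply/germP; have [I [fI sI eqI]] := germ_repr f.
by apply: (germ_pw fI) => a Ia; have [] := sI _ Ia; rewrite /= eqI.
Qed.

Lemma loc_scaleE c f : loc_scale c (\pi_fc_loc f) = \pi_fc_loc (fch_scale c f).
Proof.
apply/germP; have [I [fI sI eqI]] := germ_repr f.
by apply: (germ_pw fI) => a Ia; have [] := sI _ Ia; rewrite /= eqI.
Qed.

Lemma loc_addE f g : loc_add (\pi_fc_loc f) (\pi_fc_loc g) = \pi_fc_loc (fch_add f g).
Proof.
apply/germP; have [I [fI sI eqI]] := germ_repr f.
have [J [fJ sJ eqJ]] := germ_repr g.
apply: (germ_pw (fc_idealI fI fJ)) => a [Ia Ja].
by have [] := sI _ Ia; have [] := sJ _ Ja; rewrite /= eqI // eqJ.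
Qed.

Lemma loc_mulE f g : loc_mul (\pi_fc_loc f) (\pi_fc_loc g) = \pi_fc_loc (fch_mul f g).
Proof.
apply/germP; have [I [fI sI eqI]] := germ_repr f.
have [J [fJ sJ eqJ]] := germ_repr g.
have fK := fc_ideal_preim (dom_fc g) fI (@homD _ _ g) (@homM _ _ g).
apply: (germ_pw (fc_idealI fJ fK)) => a [Ja [ga Ia]].
by have [] := sI _ Ia; have [? _] := sJ _ Ja; rewrite /= eqJ // eqI.
Qed.

Lemma loc_addA : associative loc_add.
Proof.
elim/quotW=> f; elim/quotW=> g; elim/quotW=> h; rewrite (loc_addE g h) (loc_addE f g) !loc_addE; apply/germP.
apply: (germ_pw (fc_idealI (dom_fc f) (fc_idealI (dom_fc g) (dom_fc h)))).
by move=> a [? [? ?]]; rewrite /= addrA; do !split.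
Qed.

Lemma loc_addC : commutative loc_add.
Proof.
elim/quotW=> f; elim/quotW=> g; rewrite !loc_addE; apply/germP.
apply: (germ_pw (fc_idealI (dom_fc f) (dom_fc g))).
by move=> a [? ?]; rewrite /= addrC; do !split.
Qed.

Lemma loc_add0 : left_id loc_zero loc_add.
Proof.
elim/quotW=> f; rewrite !loc_addE; apply/germP; apply: (germ_pw (dom_fc f)).
by move=> a ?; rewrite /= add0r; do !split.
Qed.

Lemma loc_addN : left_inverse loc_zero loc_opp loc_add.
Proof.
elim/quotW=> f; rewrite loc_oppE loc_addE; apply/germP.
by apply: (germ_pw (dom_fc f)) => a ?; rewrite /= addNr; do !split.
Qed.

HB.instance Definition _ :=
  GRing.isZmodule.Build fc_loc loc_addA loc_addC loc_add0 loc_addN.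

Lemma loc_mulA : associative loc_mul.
Proof.
elim/quotW=> f; elim/quotW=> g; elim/quotW=> h; rewrite (loc_mulE g h) (loc_mulE f g) !loc_mulE; apply/germP.
by apply: (germ_pw (dom_fc (fch_mul f (fch_mul g h)))) => a [[? ?] ?]; do !split.
Qed.

Lemma loc_mul1l : left_id loc_one loc_mul.
Proof.
elim/quotW=> f; rewrite !loc_mulE; apply/germP.
by apply: (germ_pw (dom_fc f)) => a ?; do !split.
Qed.

Lemma loc_mul1r : right_id loc_one loc_mul.
Proof.
elim/quotW=> f; rewrite !loc_mulE; apply/germP.
by apply: (germ_pw (dom_fc f)) => a ?; do !split.
Qed.

Lemma loc_mulDl : left_distributive loc_mul loc_add.
Proof.
elim/quotW=> f; elim/quotW=> g; elim/quotW=> h.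
rewrite (loc_addE f g) (loc_mulE f h) (loc_mulE g h) loc_mulE loc_addE; apply/germP.
by apply: (germ_pw (dom_fc (fch_mul (fch_add f g) h))) => a [? [? ?]]; do !split.
Qed.

Lemma loc_mulDr : right_distributive loc_mul loc_add.
Proof.
elim/quotW=> f; elim/quotW=> g; elim/quotW=> h.
rewrite (loc_addE g h) (loc_mulE f h) (loc_mulE f g) loc_mulE loc_addE; apply/germP.
apply: (germ_pw (dom_fc (fch_add (fch_mul f g) (fch_mul f h)))).
move=> a [[? gd] [? hd]]; rewrite /= homD //; split=> //; split=> //.
by have [[_ D _] _] := dom_fc f; apply: D.
Qed.

HB.instance Definition _ := GRing.Zmodule_isPzRing.Build fc_loc
  loc_mulA loc_mul1l loc_mul1r loc_mulDl loc_mulDr.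

Lemma loc_scaleA (a b : k) (u : fc_loc) :
  loc_scale a (loc_scale b u) = loc_scale (a * b) u.
Proof.
elim/quotW: u => f; rewrite (loc_scaleE b f) !loc_scaleE; apply/germP.
by apply: (germ_pw (dom_fc f)) => x ?; rewrite /= scalerA.
Qed.

Lemma loc_scale1 : left_id 1 loc_scale.
Proof.
elim/quotW=> f; rewrite !loc_scaleE; apply/germP.
by apply: (germ_pw (dom_fc f)) => x ?; rewrite /= scale1r.
Qed.

Lemma loc_scaleDr : right_distributive loc_scale +%R.
Proof.
move=> a; elim/quotW=> f; elim/quotW=> g.
rewrite /GRing.add /= (loc_addE f g) (loc_scaleE a f) (loc_scaleE a g)
  loc_scaleE loc_addE; apply/germP.
apply: (germ_pw (dom_fc (fch_add f g))) => x [? ?].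
by rewrite /= scalerDr.
Qed.

Lemma loc_scaleDl (u : fc_loc) :
  {morph loc_scale^~ u : a b / a + b}.
Proof.
elim/quotW: u => f a b /=.
rewrite [RHS]/GRing.add /= (loc_scaleE a f) (loc_scaleE b f) loc_scaleE
  loc_addE; apply/germP.
by apply: (germ_pw (dom_fc f)) => x ?; rewrite /= scalerDl.
Qed.

HB.instance Definition _ := GRing.Zmodule_isLmodule.Build k fc_loc
  loc_scaleA loc_scale1 loc_scaleDr loc_scaleDl.

Lemma loc_scaleAl (c : k) (u v : fc_loc) : c *: (u * v) = (c *: u) * v.
Proof.
elim/quotW: u => f; elim/quotW: v => g.
rewrite /GRing.mul /GRing.scale /= (loc_mulE f g) (loc_scaleE c f) loc_scaleE
  loc_mulE.
by apply/germP; apply: (germ_pw (dom_fc (fch_mul f g))) => x [? ?].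
Qed.

Lemma loc_scaleAr (c : k) (u v : fc_loc) : c *: (u * v) = u * (c *: v).
Proof.
elim/quotW: u => f; elim/quotW: v => g.
rewrite /GRing.mul /GRing.scale /= (loc_mulE f g) (loc_scaleE c g) loc_scaleE
  loc_mulE.
apply/germP; apply: (germ_pw (dom_fc (fch_mul f g))) => x [? fx].
split=> //=; last by rewrite -[c *: hom g x]mulr_algr homM // mulr_algr.
by split=> //; apply: (lin_closedZ _ (fc_ideal_lin (dom_fc f))).
Qed.

(* The hypothesis is needed: R_fc is the zero ring when R is
   finite-dimensional, as the zero ideal then has finite codimension. *)
Lemma loc_one_neq0 : ~ @finite_codim k A [set 0] -> 1 != 0 :> fc_loc.
Proof.
move=> infA; apply/eqP => /germP[I [[_ [d [b spanI]]] _ I0]]; apply: infA.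
by exists d, b => v; have [c /I0 /= E] := spanI v; exists c.
Qed.

End Localization.

(* The right R-module M seen as a k-space, for R a k-algebra. *)
Definition restrict_scalars (k : fieldType) (A : algType k)
  (M : lmodType A^c) : Type := M.

Section RestrictScalars.
Variables (k : fieldType) (A : algType k) (M : lmodType A^c).

HB.instance Definition _ := GRing.Zmodule.on (restrict_scalars M).

Definition kscale (c : k) (v : restrict_scalars M) : restrict_scalars M :=
  ((c%:A : A) : A^c) *: (v : M).

Lemma kscaleA a b v : kscale a (kscale b v) = kscale (a * b) v.
Proof.
have E : (a * b)%:A = b%:A * a%:A :> A by rewrite mulr_algl scalerA mulrC.
by rewrite /kscale scalerA E.
Qed.

Lemma kscale1 : left_id 1 kscale.
Proof. by move=> v; rewrite /kscale scale1r; apply: (@scale1r A^c M). Qed.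

Lemma kscaleDr : right_distributive kscale +%R.
Proof. by move=> c u v; apply: (@scalerDr A^c M). Qed.

Lemma kscaleDl v : {morph kscale^~ v : a b / a + b}.
Proof. by move=> a b; rewrite /kscale scalerDl; apply: (@scalerDl A^c M). Qed.

HB.instance Definition _ := GRing.Zmodule_isLmodule.Build k
  (restrict_scalars M) kscaleA kscale1 kscaleDr kscaleDl.

End RestrictScalars.

Section RightModules.
Variable R : pzRingType.

Definition finitely_generated (P : lmodType R^c) : Prop :=
  exists (m : nat) (p : 'I_m -> P), forall v : P,
    exists r : 'I_m -> R^c, v = \sum_i r i *: p i.

Definition projective (P : lmodType R^c) : Prop :=
  forall (M N : lmodType R^c) (g : {linear M -> N}) (h : {linear P -> N}),
    (forall y, exists x, g x = y) ->
    exists h' : {linear P -> M}, forall v, g (h' v) = h v.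

End RightModules.

Definition hom_class (R : pzRingType) : Type :=
  forall P P' : lmodType R^c, {linear P -> P'} -> Prop.

Definition Sigma_fc (k : fieldType) (A : algType k) : hom_class A :=
  fun P P' s =>
    [/\ finitely_generated P /\ projective P,
        finitely_generated P' /\ projective P',
        injective s
      & finite_codim (range s : set (restrict_scalars P'))].

(* The right T-module P (x)_R T, for f : R -> T: formal sums of pairs (p, t),
   written as sequences, modulo the congruence generated by the tensor
   relations. *)
Section BaseChange.
Variables (R T : pzRingType) (f : {rmorphism R -> T}).

Section Module.
Variable P : lmodType R^c.

Inductive tensor_eq : seq (P * T) -> seq (P * T) -> Prop :=
| tensor_refl x : tensor_eq x x
| tensor_sym x y : tensor_eq x y -> tensor_eq y x
| tensor_trans x y z : tensor_eq x y -> tensor_eq y z -> tensor_eq x z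
| tensor_cat x x' y y' :
    tensor_eq x x' -> tensor_eq y y' -> tensor_eq (x ++ y) (x' ++ y')
| tensor_catC x y : tensor_eq (x ++ y) (y ++ x)
| tensor_0 t : tensor_eq [:: (0, t)] [::]
| tensor_Dl p q t : tensor_eq [:: (p + q, t)] [:: (p, t); (q, t)]
| tensor_Dr p t u : tensor_eq [:: (p, t + u)] [:: (p, t); (p, u)]
| tensor_M p (r : R) t :
    tensor_eq [:: ((r : R^c) *: p, t)] [:: (p, f r * t)].

Definition tensor_eqb x y : bool := `[< tensor_eq x y >].

Lemma tensor_eqb_refl : reflexive tensor_eqb.
Proof. by move=> x; apply/asboolP/tensor_refl. Qed.

Lemma tensor_eqb_sym : symmetric tensor_eqb.
Proof. by move=> x y; apply: asbool_equiv_eq; split; apply: tensor_sym. Qed.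

Lemma tensor_eqb_trans : transitive tensor_eqb.
Proof.
by move=> y x z /asboolP xy /asboolP yz; apply/asboolP/(tensor_trans xy).
Qed.

Canonical tensor_equiv :=
  EquivRel tensor_eqb tensor_eqb_refl tensor_eqb_sym tensor_eqb_trans.

Definition base_change : Type := {eq_quot tensor_equiv}.
HB.instance Definition _ := Choice.on base_change.
HB.instance Definition _ := EqQuotient.on base_change.

Lemma tensorP x y : tensor_eq x y <-> \pi_base_change x = \pi_base_change y.
Proof.
by split=> [E|/eqquotP/asboolP//]; apply/eqquotP/asboolP.
Qed.

Lemma tensor_repr x : tensor_eq (repr (\pi_base_change x)) x.
Proof. by apply/tensorP; rewrite reprK. Qed.

Definition formal_opp (x : seq (P * T)) := [seq (- a.1, a.2) | a <- x].
Definition formal_scale (u : T) (x : seq (P * T)) :=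
  [seq (a.1, a.2 * u) | a <- x].

Lemma formal_opp_eq x y :
  tensor_eq x y -> tensor_eq (formal_opp x) (formal_opp y).
Proof.
elim=> {x y} [x|x y _ E|x y z _ E _ F|x x' y y' _ E _ F|x y|t|p q t|p t u|p r t].
- exact: tensor_refl.
- exact: tensor_sym.
- exact: tensor_trans E F.
- by rewrite /formal_opp !map_cat; apply: tensor_cat.
- by rewrite /formal_opp !map_cat; apply: tensor_catC.
- by rewrite /= oppr0; apply: tensor_0.
- by rewrite /= opprD; apply: tensor_Dl.
- exact: tensor_Dr.
- by rewrite /= -scalerN; apply: tensor_M.
Qed.

Lemma formal_scale_eq u x y :
  tensor_eq x y -> tensor_eq (formal_scale u x) (formal_scale u y).
Proof.
elim=> {x y} [x|x y _ E|x y z _ E _ F|x x' y y' _ E _ F|x y|t|p q t|p t v|p r t].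
- exact: tensor_refl.
- exact: tensor_sym.
- exact: tensor_trans E F.
- by rewrite /formal_scale !map_cat; apply: tensor_cat.
- by rewrite /formal_scale !map_cat; apply: tensor_catC.
- exact: tensor_0.
- exact: tensor_Dl.
- by rewrite /= mulrDl; apply: tensor_Dr.
- by rewrite /= -mulrA; apply: tensor_M.
Qed.

Definition bc_zero : base_change := \pi_base_change [::].
Definition bc_add (x y : base_change) : base_change :=
  \pi_base_change (repr x ++ repr y).
Definition bc_opp (x : base_change) : base_change :=
  \pi_base_change (formal_opp (repr x)).
Definition bc_scale (u : T^c) (x : base_change) : base_change :=
  \pi_base_change (formal_scale u (repr x)).

Lemma bc_addE x y :
  bc_add (\pi_base_change x) (\pi_base_change y) = \pi_base_change (x ++ y).
Proof. by apply/tensorP/tensor_cat; apply: tensor_repr. Qed.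

Lemma bc_oppE x : bc_opp (\pi_base_change x) = \pi_base_change (formal_opp x).
Proof. exact/tensorP/formal_opp_eq/tensor_repr. Qed.

Lemma bc_scaleE u x :
  bc_scale u (\pi_base_change x) = \pi_base_change (formal_scale u x).
Proof. exact/tensorP/formal_scale_eq/tensor_repr. Qed.

Lemma bc_addA : associative bc_add.
Proof.
elim/quotW=> x; elim/quotW=> y; elim/quotW=> z.
by rewrite (bc_addE y z) (bc_addE x y) !bc_addE catA.
Qed.

Lemma bc_addC : commutative bc_add.
Proof.
elim/quotW=> x; elim/quotW=> y.
by rewrite (bc_addE x y) (bc_addE y x); apply/tensorP/tensor_catC.
Qed.

Lemma bc_add0 : left_id bc_zero bc_add.
Proof. by elim/quotW=> x; rewrite bc_addE. Qed.

Lemma bc_addN : left_inverse bc_zero bc_opp bc_add.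
Proof.
elim/quotW=> x; rewrite bc_oppE bc_addE; apply/tensorP.
elim: x => [|[p t] x IH]; first exact: tensor_refl.
rewrite -[_ :: x]cat1s /formal_opp map_cat -catA.
apply: (@tensor_trans _ ([:: (- p, t)] ++ [:: (p, t)] ++ (formal_opp x ++ x))).
  apply: tensor_cat; first exact: tensor_refl.
  rewrite !catA; apply: tensor_cat; last exact: tensor_refl.
  exact: tensor_catC.
rewrite catA -[X in tensor_eq _ X]cats0 -[X in tensor_eq _ (X ++ _)]cats0 cats0.
apply: (@tensor_cat _ [::] _ [::]) => //.
apply: tensor_trans (tensor_0 t); apply: tensor_sym.
by rewrite -[0](addNr p); apply: tensor_Dl.
Qed.

HB.instance Definition _ :=
  GRing.isZmodule.Build base_change bc_addA bc_addC bc_add0 bc_addN.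

Lemma bc_scaleA (a b : T^c) (x : base_change) :
  bc_scale a (bc_scale b x) = bc_scale (a * b) x.
Proof.
elim/quotW: x => x; rewrite (bc_scaleE b x) !bc_scaleE.
congr (\pi_base_change _).
by rewrite /formal_scale -map_comp; apply: eq_map => -[p t] /=; rewrite -mulrA.
Qed.

Lemma bc_scale1 : left_id 1 bc_scale.
Proof.
elim/quotW=> x; rewrite bc_scaleE; congr (\pi_base_change _).
by rewrite -[RHS]map_id; apply: eq_map => -[p t] /=; rewrite mulr1.
Qed.

Lemma bc_scaleDr : right_distributive bc_scale +%R.
Proof.
move=> a; elim/quotW=> x; elim/quotW=> y; rewrite /GRing.add /=.
rewrite (bc_addE x y) (bc_scaleE a x) (bc_scaleE a y) bc_scaleE bc_addE.
by rewrite /formal_scale map_cat.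
Qed.

Lemma bc_scaleDl (x : base_change) : {morph bc_scale^~ x : a b / a + b}.
Proof.
elim/quotW: x => x a b /=; rewrite [RHS]/GRing.add /=.
rewrite (bc_scaleE a x) (bc_scaleE b x) bc_scaleE bc_addE; apply/tensorP.
elim: x => [|[p t] x IH]; first exact: tensor_refl.
rewrite /= -[_ :: formal_scale (a + b) x]cat1s mulrDr.
apply: tensor_trans (tensor_cat (tensor_Dr _ _ _) IH) _ => /=.
set X := formal_scale a x; set Y := formal_scale b x.
have -> : X ++ (p, t * b) :: Y = (X ++ [:: (p, t * b)]) ++ Y by rewrite -catA.
apply: (@tensor_cat [:: _] [:: _]); first exact: tensor_refl.
apply: (@tensor_cat ([:: _] ++ X)); last exact: tensor_refl.
exact: tensor_catC.
Qed.

HB.instance Definition _ := GRing.Zmodule_isLmodule.Build T^c base_change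
  bc_scaleA bc_scale1 bc_scaleDr bc_scaleDl.

Definition tensor (p : P) (t : T) : base_change := \pi_base_change [:: (p, t)].

End Module.

(* s (x)_R 1_T *)
Section Map.
Variables (P P' : lmodType R^c) (s : {linear P -> P'}).

Definition formal_map (x : seq (P * T)) : seq (P' * T) :=
  [seq (s a.1, a.2) | a <- x].

Definition base_change_map (x : base_change P) : base_change P' :=
  \pi_(base_change P') (formal_map (repr x)).

Lemma formal_map_eq x y :
  tensor_eq x y -> tensor_eq (formal_map x) (formal_map y).
Proof.
elim=> {x y} [x|x y _ E|x y z _ E _ F|x x' y y' _ E _ F|x y|t|p q t|p t v|p r t].
- exact: tensor_refl.
- exact: tensor_sym.
- exact: tensor_trans E F.
- by rewrite /formal_map !map_cat; apply: tensor_cat.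
- by rewrite /formal_map !map_cat; apply: tensor_catC.
- by rewrite /= linear0; apply: tensor_0.
- by rewrite /= linearD; apply: tensor_Dl.
- exact: tensor_Dr.
- by rewrite /= linearZ; apply: tensor_M.
Qed.

Lemma base_change_mapE x : base_change_map (\pi_(base_change P) x) =
  \pi_(base_change P') (formal_map x).
Proof. exact/tensorP/formal_map_eq/tensor_repr. Qed.

Lemma base_change_map_tensor p t :
  base_change_map (tensor p t) = tensor (s p) t.
Proof. exact: base_change_mapE. Qed.

Lemma base_change_map_linear : linear base_change_map.
Proof.
move=> a; elim/quotW=> x; elim/quotW=> y.
rewrite /GRing.add /GRing.scale /= (base_change_mapE x) (base_change_mapE y).
rewrite (bc_scaleE a x) (bc_scaleE a (formal_map x)) bc_addE bc_addE.
rewrite base_change_mapE; congr (\pi_(base_change P') _).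
by rewrite /formal_map /formal_scale map_cat -!map_comp.
Qed.

HB.instance Definition _ := GRing.isLinear.Build T^c
  (base_change P) (base_change P') _ base_change_map base_change_map_linear.

End Map.

Definition inverting (S : hom_class R) : Prop :=
  forall (P P' : lmodType R^c) (s : {linear P -> P'}),
    S P P' s -> bijective (base_change_map s).

End BaseChange.

Definition universal_localization (R Q : pzRingType) (S : hom_class R)
    (lambda : {rmorphism R -> Q}) : Prop :=
  inverting lambda S /\
  forall (T : pzRingType) (f : {rmorphism R -> T}), inverting f S ->
    (exists h : {rmorphism Q -> T}, h \o lambda =1 f) /\
    (forall h h' : {rmorphism Q -> T},
       h \o lambda =1 f -> h' \o lambda =1 f -> h =1 h').

(* k<x_0, ..., x_n>, the algebra over k of the free monoid on 'I_n.+1 *)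
Definition free_alg (k : fieldType) (n : nat) : Type :=
  {malg k[{fmonom 'I_n.+1}]}.

Section FreeAlgebra.
Variables (k : fieldType) (n : nat).

HB.instance Definition _ := GRing.Lalgebra.on (free_alg k n).

Lemma free_alg_scaleAr (c : k) (x y : free_alg k n) :
  c *: (x * y) = x * (c *: y).
Proof.
apply/malgP=> m.
rewrite mcoeffZ (mcoeffMlw _ (finmap.fsubset_refl _) (msuppZ_le c y)) mcoeffMl.
rewrite mulr_sumr; apply: eq_bigr => m1 _; rewrite mulr_sumr.
by apply: eq_bigr => m2 _; rewrite mcoeffZ mulrnAr mulrCA.
Qed.

HB.instance Definition _ :=
  GRing.Lalgebra_isAlgebra.Build k (free_alg k n) free_alg_scaleAr.

Lemma free_alg_infinite : ~ @finite_codim k (free_alg k n) [set 0].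
Proof.
move=> [d [b span]]; pose X j : {fmonom 'I_n.+1} := FMonom (nseq j ord0).
have /choice[c cP] : forall j : 'I_d.+1, exists c : 'I_d -> k,
    << X j >> = \sum_i c i *: b i :> free_alg k n.
  by move=> j; have [c /subr0_eq E] := span << X j >>; exists c.
pose C := \matrix_(j, i) c j i.
pose B := \matrix_(i < d, j < d.+1) (b i)@_(X j).
have CB1 : C *m B = 1%:M.
  apply/matrixP=> i j; rewrite !mxE.
  transitivity ((<< X i >> : free_alg k n)@_(X j)).
    rewrite cP raddf_sum; apply: eq_bigr => l _.
    by rewrite !mxE; apply/esym/mcoeffZ.
  rewrite mcoeffU1; congr (nat_of_bool _)%:R; apply/eqP/eqP => [[E]|->//].
  by apply/val_inj; have := congr1 size E; rewrite !size_nseq.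
have := mxrankM_maxr C B; rewrite CB1 mxrank1.
by move=> /leq_trans/(_ (rank_leq_row B)); rewrite ltnn.
Qed.

Lemma fc_loc_free_alg_one_neq0 : 1 != 0 :> fc_loc (free_alg k n).
Proof. exact/loc_one_neq0/free_alg_infinite. Qed.

HB.instance Definition _ := GRing.PzSemiRing_isNonZero.Build
  (fc_loc (free_alg k n)) fc_loc_free_alg_one_neq0.
HB.instance Definition _ := GRing.Lmodule_isLalgebra.Build k
  (fc_loc (free_alg k n)) (@loc_scaleAl k (free_alg k n)).
HB.instance Definition _ := GRing.Lalgebra_isAlgebra.Build k
  (fc_loc (free_alg k n)) (@loc_scaleAr k (free_alg k n)).

End FreeAlgebra.

(* Main.v *)
From HB Require Import structures.
From mathcomp Require Import all_boot all_algebra.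
From mathcomp Require Import finmap boolp classical_sets monalg.
Require Import Defs.

(** Both rings classify the same thing.  Call a ring homomorphism f : A -> T
closing if, for every right T-module X and every right ideal I of finite
codimension, each A-linear map I -> X is a |-> y f(a) for exactly one y in X;
in other words, if restriction Hom_A(A, X) -> Hom_A(I, X) is bijective.

If f is closing then f inverts Sigma ([closing_inverting]).  For a monomorphism
s : P -> P' with image of finite codimension and q in P', the a with q a in
s(P) form a right ideal of finite codimension, and a |-> s^-1(q a) (x) 1 is
A-linear from it to X = P (x) T, hence is given by one element of X; this
element is the image of q (x) 1 under the inverse of s (x) 1.

Suppose now that every right ideal I of finite codimension has a dual basis
(a_i, c_i), that is, is finitely generated projective.  Then the inclusion
I -> A lies in Sigma, and a map f inverting it is closing
([inverting_closing]): Hom_A(I, X) = Hom_T(I (x) T, X) = Hom_T(A (x) T, X) = X.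
Moreover the canonical map loc : A -> A_fc is closing ([loc_closing]), because
the germs [c_i] satisfy sum_i [a_i] [c_i] = 1.  Every closing f : A -> T factors
uniquely through loc ([loc_ext], [loc_ext_uniq]): the image of the germ of
h : I -> A is the y with f(h(a)) = y f(a) on I.  So loc has the universal
property of the localization at Sigma ([fc_loc_universal]).

It remains to find dual bases in a free algebra
([word_basis_hereditary]).  Let b be a basis modulo I and let cf_i(u) be the
i-th coordinate of the class of u.  Put a_0 = 1 - sum_i cf_i(1) b_i and
a_(i,x) = b_i x - sum_j cf_j(b_i x) b_j for each letter x; these lie in I.
Reading a word letter by letter and reducing the prefix read so far gives

  u - sum_i cf_i(u) b_i = a_0 u + sum_(i,x) a_(i,x) D_(i,x)(u),

where D_(i,x) is the k-linear map with D(1) = 0 and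
D(u y) = D(u) y + [x = y] cf_i(u).  On I the coordinates cf_i vanish, so D_(i,x)
is A-linear there and the identity says that the a's and D's, together with
the identity of I, are a dual basis. *)

Set Implicit Arguments.
Unset Strict Implicit.
Unset Printing Implicit Defensive.

Import GRing.Theory.

Local Open Scope ring_scope.
Local Open Scope quotient_scope.

(** * Base change of right modules *)

Section BaseChangeUniversal.
Variables (R T : pzRingType) (f : {rmorphism R -> T}).

(** The right action written x t = t *: x: products in [T] appear in the order
in which they act, so [a] acts before [b]. *)
Lemma rscaleA (X : lmodType T^c) (a b : T) (x : X) :
  (b : T^c) *: ((a : T^c) *: x) = ((a * b : T) : T^c) *: x.
Proof. exact: scalerA. Qed.

Variable P : lmodType R^c.

Lemma bc_ind (K : base_change f P -> Prop) :
  K 0 -> (forall x y, K x -> K y -> K (x + y)) ->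
  (forall p t, K (tensor f p t)) -> forall x, K x.
Proof.
move=> K0 KD Kt; elim/quotW=> x; elim: x => [//|[p t] x IH].
by rewrite -cat1s -bc_addE; apply: KD => //; apply: Kt.
Qed.

Lemma tensorDl p q t :
  tensor f (p + q) t = tensor f p t + tensor f q t :> base_change f P.
Proof. by rewrite [RHS]bc_addE; apply/tensorP/tensor_Dl. Qed.

Lemma tensorZ p (t u : T) :
  (u : T^c) *: tensor f p t = tensor f p (t * u) :> base_change f P.
Proof. exact: bc_scaleE. Qed.

Lemma tensorM p (r : R) t :
  tensor f ((r : R^c) *: p) t = tensor f p (f r * t) :> base_change f P.
Proof. exact/tensorP/tensor_M. Qed.

(** P (x) T is generated over T by the tensors p (x) 1. *)
Lemma bc_eq (X : lmodType T^c) (G H : {linear base_change f P -> X}) :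
  (forall p, G (tensor f p 1) = H (tensor f p 1)) -> G =1 H.
Proof.
move=> GH; elim/bc_ind=> [|x y IHx IHy|p t]; first by rewrite !linear0.
  by rewrite !linearD IHx IHy.
by rewrite -[t]mul1r -tensorZ !linearZ /= GH.
Qed.

Variables (X : lmodType T^c) (g : P -> X).
Hypothesis gD : {morph g : p q / p + q}.
Hypothesis gM : forall p (r : R), g ((r : R^c) *: p) = (f r : T^c) *: g p.

Let ev (x : seq (P * T)) : X := \sum_(a <- x) (a.2 : T^c) *: g a.1.

Lemma ev_eq x y : tensor_eq f x y -> ev x = ev y.
Proof.
rewrite /ev; elim=> {x y}
  [//|x y _ -> //|x y z _ -> _ //|x x' y y' _ E _ F|x y|t|p q t|p t u|p r t].
- by rewrite !big_cat E F.
- by rewrite !big_cat /= addrC.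
- have g0 : g 0 = 0 by apply: (addrI (g 0)); rewrite -gD !addr0.
  by rewrite big_seq1 big_nil g0 scaler0.
- by rewrite !big_cons !big_nil !addr0 gD scalerDr.
- by rewrite !big_cons !big_nil !addr0 -scalerDl.
- by rewrite !big_seq1 gM rscaleA.
Qed.

(** Adjunction: an R-linear map on P extends to a T-linear map on P (x) T;
together with [bc_eq] this is Hom_R(P, X) = Hom_T(P (x)_R T, X). *)
Lemma bc_ext : exists G : {linear base_change f P -> X},
  forall p, G (tensor f p 1) = g p.
Proof.
pose G (x : base_change f P) := ev (repr x).
have GE x : G (\pi x) = ev x by exact/ev_eq/tensor_repr.
have Glin : linear G.
  move=> u; elim/quotW=> x; elim/quotW=> y.
  rewrite [_ *: _]bc_scaleE [_ + _ in LHS]bc_addE !GE /ev big_cat big_map /=.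
  congr (_ + _); rewrite scaler_sumr; apply: eq_bigr => a _; exact/esym/rscaleA.
pose mG := GRing.isLinear.Build _ _ _ _ G Glin.
exists (HB.pack_for {linear base_change f P -> X} G mG) => p /=.
by rewrite GE /ev big_seq1 scale1r.
Qed.

End BaseChangeUniversal.

(** * Closing homomorphisms and dual bases *)

Section Closed.
Variables (k : fieldType) (A : algType k).
Implicit Types (I : set A).

(** Functions on all of [A] stand for module maps on [I]; only their values on
[I] matter.  The target acts through [act], so that [A] itself and modules over
another ring are both covered. *)
Definition hom_on I (B : zmodType) (act : B -> A -> B) (phi : A -> B) : Prop :=
  (forall a b, I a -> I b -> phi (a + b) = phi a + phi b) /\
  (forall a r, I a -> phi (a * r) = act (phi a) r).

Definition dual_basis I : Prop :=
  exists (m : nat) (a : 'I_m -> A) (c : 'I_m -> A -> A),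
    [/\ forall i, I (a i), forall i, hom_on I *%R (c i)
      & forall x, I x -> x = \sum_i a i * c i x].

Definition fc_hereditary : Prop := forall I, fc_ideal I -> dual_basis I.

Definition res_act (T : pzRingType) (f : A -> T)
    (X : lmodType T^c) (x : X) (r : A) : X :=
  (f r : T^c) *: x.

(** Existence says that every T-module is divisible, uniqueness that it is
torsion-free, for the topology of right ideals of finite codimension. *)
Definition fc_closing (T : pzRingType) (f : {rmorphism A -> T}) : Prop :=
  forall (X : lmodType T^c) I (phi : A -> X),
    fc_ideal I -> hom_on I (res_act f (X := X)) phi ->
  exists! x : X, forall a, I a -> phi a = res_act f x a.

Lemma hom_on_sum I (B : zmodType) act (phi : A -> B) m (a r : 'I_m -> A) :
  fc_ideal I -> hom_on I act phi -> (forall i, I (a i)) ->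
  phi (\sum_i a i * r i) = \sum_i act (phi (a i)) (r i).
Proof.
move=> [[I0 ID IM] _] [phiD phiM] Ia.
have phi0 : phi 0 = 0 by apply: (addrI (phi 0)); rewrite -phiD // !addr0.
suff [] : I (\sum_i a i * r i) /\
  phi (\sum_i a i * r i) = \sum_i act (phi (a i)) (r i) by [].
elim/big_ind2: _ => [//|x1 x2 y1 y2 [Ix <-] [Iy <-]|i _].
  by split; [apply: ID|rewrite phiD].
by split; [apply: IM|rewrite phiM].
Qed.

(** Both [x] and [y] represent the map a |-> x f(a) on [I]. *)
Lemma fc_closing_inj (T : pzRingType) (f : {rmorphism A -> T}) I :
  fc_closing f -> fc_ideal I -> forall (X : lmodType T^c) (x y : X),
  (forall a, I a -> res_act f x a = res_act f y a) -> x = y.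
Proof.
move=> fc fI X x y xy; have [|z [_ zu]] := fc X I (res_act f x) fI.
  split=> [a b _ _|a r _]; first by rewrite /res_act rmorphD scalerDl.
  by rewrite /res_act rscaleA -rmorphM.
by rewrite -(zu x) // -(zu y).
Qed.

End Closed.

Section DualBasisProjective.
Variables (k : fieldType) (A : algType k).

(** The dual basis lemma: a lift of [h] is x |-> sum_i y_i c_i(x) with y_i over
h(a_i). *)
Lemma dual_basis_projective m (P : lmodType A^c)
    (a : 'I_m -> P) (c : 'I_m -> P -> A) :
  (forall i, {morph c i : x y / x + y}) ->
  (forall i x (r : A), c i ((r : A^c) *: x) = c i x * r) ->
  (forall x, x = \sum_i (c i x : A^c) *: a i) ->
  finitely_generated P /\ projective P.
Proof.
move=> cD cM cE; split; first by exists m, a => x; exists (fun i => c i x).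
move=> M N g h gs; have /choice[y gy] i := gs (h (a i)).
pose h' x : M := \sum_i (c i x : A^c) *: y i.
have h'lin : linear h'.
  move=> r u v; rewrite /h' scaler_sumr -big_split; apply: eq_bigr => i _ /=.
  by rewrite cD cM scalerDl scalerA.
pose mh := GRing.isLinear.Build _ _ _ _ h' h'lin.
exists (HB.pack_for {linear P -> M} h' mh) => x /=.
rewrite [in RHS](cE x) !linear_sum; apply: eq_bigr => i _ /=.
by rewrite !linearZ /= gy.
Qed.

End DualBasisProjective.

(** * Right ideals of finite codimension as modules *)

Section IdealModule.
Variables (k : fieldType) (A : algType k) (I : set A) (rI : right_ideal I).

(** Closure under the module operations depends on the ideal axioms; taking their
proof as an argument ties the module structure to the type. *)
Definition ideal_pred (_ : right_ideal I) : pred ((A^c)^o : lmodType A^c) :=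
  fun x => `[< I x >].

Lemma ideal_submod : GRing.submod_closed (ideal_pred rI).
Proof.
have [I0 ID IM] := rI; split=> [|r x y]; first exact/asboolP.
by move=> /asboolP Ix /asboolP Iy; apply/asboolP/ID => //; apply: IM.
Qed.

HB.instance Definition _ :=
  GRing.isSubmodClosed.Build A^c ((A^c)^o : lmodType A^c) (ideal_pred rI) ideal_submod.

Definition ideal_mod : Type := {x : ((A^c)^o : lmodType A^c) | ideal_pred rI x}.

HB.instance Definition _ := [isSub of ideal_mod for @sval _ _].
HB.instance Definition _ := [Choice of ideal_mod by <:].
HB.instance Definition _ := [SubChoice_isSubLmodule of ideal_mod by <:].

Definition ideal_incl : ideal_mod -> (A^c)^o := val.
HB.instance Definition _ := GRing.Linear.on ideal_incl.

Lemma ideal_inclP x : I (ideal_incl x).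
Proof. exact/asboolP/(valP x). Qed.

Lemma ideal_inclK a : I a -> exists x, ideal_incl x = a.
Proof. by move=> Ia; exists (exist _ a (asboolT Ia)). Qed.

End IdealModule.

Section InvertingClosing.
Variables (k : fieldType) (A : algType k).
Variables (T : pzRingType) (f : {rmorphism A -> T}).

Lemma ideal_incl_Sigma (I : set A) (fI : fc_ideal I) :
  dual_basis I -> Sigma_fc (@ideal_incl k A I fI.1).
Proof.
move=> [m [a [c [Ia ch cE]]]].
have /choice[a' a'E] i := ideal_inclK fI.1 (Ia i).
split; last 2 first.
- exact: val_inj.
- have [_ [d [b bP]]] := fI; exists d, b => v; have [x Ix] := bP v.
  exists x; have [y yE] := ideal_inclK fI.1 Ix; exists y => //.
  apply: etrans yE _; congr (_ - _); apply: eq_bigr => i _.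
  exact/esym/(mulr_algr (x i) (b i)).
- apply: (dual_basis_projective (a := a') (c := fun i x => c i (ideal_incl x))).
  + by move=> i x y; apply: (ch i).1; apply: ideal_inclP.
  + by move=> i x r; apply: (ch i).2; apply: ideal_inclP.
  move=> x; apply: val_inj; rewrite -![val _]/(ideal_incl _) linear_sum.
  rewrite [LHS]cE; last exact: ideal_inclP.
  by apply: eq_bigr => i _; rewrite linearZ /= a'E.
- apply: (@dual_basis_projective k A 1 (A^c)^o (fun=> 1) (fun _ x => x)) => // x.
  by rewrite big_ord1; exact/esym/(mul1r (x : A)).
Qed.

(** The preimage [F e] of 1 (x) 1 under I (x) T -> A (x) T is the universal
element: a map on [I] is determined by the image of [F e] under its extension
to I (x) T. *)
Lemma inverting_closing :
  fc_hereditary A -> inverting f (@Sigma_fc k A) -> fc_closing f.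
Proof.
move=> hA invf X I phi fI [phiD phiM].
have [F inclK FK] := invf _ _ _ (ideal_incl_Sigma fI (hA _ fI)).
have [||Phi PhiE] := @bc_ext _ _ f (ideal_mod fI.1) X (phi \o (@ideal_incl _ _ _ _)).
- by move=> x y; apply: phiD; apply: ideal_inclP.
- by move=> x r; apply: phiM; apply: ideal_inclP.
pose e := tensor f (1 : (A^c)^o) 1.
(* a (x) 1 in I (x) T is [F e] times f(a): both go to 1 (x) f(a) in A (x) T. *)
have Fe (a : ideal_mod fI.1) : tensor f a 1 = (f (ideal_incl a) : T^c) *: F e.
  apply: (can_inj inclK); rewrite linearZ /= FK base_change_map_tensor.
  rewrite tensorZ mul1r -[f _]mulr1 -tensorM; congr tensor.
  exact/esym/(mul1r (_ : A)).
exists (Phi (F e)); split=> [a Ia|y yP].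
  have [x <-] := ideal_inclK fI.1 Ia.
  by rewrite /res_act -linearZ /= -Fe PhiE.
(* A candidate y extends to [Psi] on A (x) T, and the restriction of [Psi] to
   I (x) T is [Phi]; evaluating at [F e] gives y = [Phi (F e)]. *)
have [||Psi PsiE] := @bc_ext _ _ f ((A^c)^o : lmodType A^c) X (fun a : A => (f a : T^c) *: y).
- by move=> a b; rewrite rmorphD scalerDl.
- by move=> a r; rewrite rscaleA -rmorphM.
have <- : Psi e = y by rewrite PsiE rmorph1 scale1r.
rewrite -[in RHS](FK e); apply/esym.
move: (F e); elim/bc_ind=> [|u v IHu IHv|p t]; first by rewrite !linear0.
  by rewrite !linearD IHu IHv.
rewrite base_change_map_tensor -[t]mul1r -!tensorZ !linearZ /= PsiE PhiE /=.
by congr (_ *: _); rewrite yP //; apply: ideal_inclP.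
Qed.

End InvertingClosing.

Section ClosingInverting.
Variables (k : fieldType) (A : algType k).
Variables (T : pzRingType) (f : {rmorphism A -> T}).

Definition conductor (P P' : lmodType A^c) (s : P -> P') (q : P') : set A :=
  fun a => range s ((a : A^c) *: q).

(** A modulo the conductor of [q] embeds into P' / s(P) by a |-> q a, and a
subspace of a finite-dimensional space is finite-dimensional. *)
Lemma conductor_fc (P P' : lmodType A^c) (s : {linear P -> P'}) (q : P') :
  finite_codim (range s : set (restrict_scalars P')) -> fc_ideal (conductor s q).
Proof.
move=> [d [b bP]]; split.
  split; first by exists 0; rewrite // linear0 scale0r.
    by move=> a r [x _ xE] [y _ yE]; exists (x + y); rewrite // linearD xE yE -scalerDl.
  by move=> a r [x _ xE]; exists ((r : A^c) *: x); rewrite // linearZ /= xE scalerA.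
have sl : @lin_closed k (restrict_scalars P') (range s).
  split; first by exists 0; rewrite ?linear0.
  move=> c u v [x _ xE] [y _ yE]; exists (((c%:A : A) : A^c) *: x + y) => //.
  by rewrite linearP xE yE.
have ql : @lin_closed k (restrict_scalars P') [set y | exists a : A, y = (a : A^c) *: q].
  split; first by exists 0; rewrite scale0r.
  move=> c _ _ [a ->] [a' ->]; exists (c *: a + a').
  by rewrite [RHS]scalerDl -mulr_algr -(scalerA (c%:A : A^c)).
have [|e [u [/choice[a ua] uP]]] := span_sub sl ql (b := b).
  by move=> v _; apply: bP.
exists e, a => v; have [|c cP] := uP ((v : A^c) *: q); first by exists v.
exists c; move: cP; congr (range s _).
rewrite [RHS]scalerBl; congr (_ - _).
rewrite [RHS]scaler_suml; apply: eq_bigr => i _.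
by rewrite ua -mulr_algr -[in RHS]scalerA.
Qed.

(** The inverse sends q (x) 1 to the element [th q] of P (x) T that represents
a |-> s^-1(q a) (x) 1 on the conductor of [q].  Uniqueness of representatives
gives additivity and linearity of [th], and both composites. *)
Lemma closing_inverting : fc_closing f -> inverting f (@Sigma_fc k A).
Proof.
move=> fc P P' s [_ _ s_inj s_fc].
pose I q := conductor s q.
have fI q : fc_ideal (I q) by exact: conductor_fc.
(* [inv] is s^-1 on the image of [s] and 0 elsewhere. *)
have /choice[inv invP] (y : P') : exists x, range s y -> s x = y.
  have [[x _ <-]|ny] := pselect (range s y); first by exists x.
  by exists 0 => /ny.
have invK x : inv (s x) = x by apply/s_inj/invP; exists x.
pose phi q (a : A) := tensor f (inv ((a : A^c) *: q)) 1.
have /choice[th thP] q : exists y, forall a, I q a -> phi q a = res_act f y a.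
  have [|y [yP _]] := fc _ _ (phi q) (fI q); last by exists y.
  split=> [a a' Ia Ia'|a r Ia]; rewrite /phi.
    rewrite scalerDl -(invP _ Ia) -(invP _ Ia') -linearD !invK.
    exact: tensorDl.
  rewrite /res_act tensorZ mul1r -[f r]mulr1 -tensorM; congr tensor.
  by rewrite -[a * r]/((r : A^c) * a) -scalerA -(invP _ Ia) -linearZ !invK.
have [|p r|Th ThE] := @bc_ext _ _ f P' _ th.
- move=> p q; apply: (fc_closing_inj fc (fc_idealI (fI p) (fI q))) => a [Ip Iq].
  rewrite [RHS]scalerDr -![_ *: _]/(res_act f _ a) -!thP //; last first.
    case: (Ip) (Iq) => [x _ xE] [y _ yE].
    by exists (x + y); rewrite // linearD xE yE scalerDr.
  rewrite /phi scalerDr -(invP _ Ip) -(invP _ Iq) -linearD !invK.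
  exact: tensorDl.
- apply: (fc_closing_inj fc (fI ((r : A^c) *: p))) => a Ia.
  rewrite -thP // /res_act rscaleA -rmorphM -[RHS]/(res_act f _ _) -thP.
    by rewrite /phi scalerA.
  by move: Ia; rewrite /I /conductor scalerA.
exists Th.
  apply: (@bc_eq _ _ f P _ (Th \o base_change_map s) idfun) => p /=.
  rewrite base_change_map_tensor ThE.
  apply: (fc_closing_inj fc (fI (s p))) => a Ia.
  by rewrite -thP // /phi -linearZ invK /res_act tensorZ mul1r tensorM mulr1.
apply: (@bc_eq _ _ f P' _ (base_change_map s \o Th) idfun) => p /=.
rewrite ThE; apply: (fc_closing_inj fc (fI p)) => a Ia.
rewrite /res_act -linearZ /= -/(res_act f (th p) a) -thP // base_change_map_tensor.
by rewrite invP // tensorZ mul1r tensorM mulr1.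
Qed.

End ClosingInverting.

(** * The universal property of the localization at the topology *)

Section Loc.
Variables (k : fieldType) (A : algType k).
Local Notation "'[' h ']'" := (\pi_(fc_loc A) h) (format "[ h ]").

Definition fch_lmul (a : A) : fc_hom A :=
  FcHom (fc_idealT A) (fun x y _ _ => mulrDr a x y) (fun x r _ => mulrA a x r).

Definition loc (a : A) : fc_loc A := [fch_lmul a].

Lemma loc_zmod_morphism : zmod_morphism loc.
Proof.
move=> a b; rewrite [- loc b]loc_oppE [RHS]loc_addE; apply/germP.
by apply: (germ_pw (fc_idealT A)) => x _; rewrite /= mulrBl.
Qed.

Lemma loc_monoid_morphism : monoid_morphism loc.
Proof.
split=> [|a b].
  by apply/germP/(germ_pw (fc_idealT A)) => x _; rewrite /= mul1r.
rewrite [RHS]loc_mulE; apply/germP.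
by apply: (germ_pw (fc_idealT A)) => x _; rewrite /= mulrA.
Qed.

HB.instance Definition _ := GRing.isZmodMorphism.Build A (fc_loc A) loc loc_zmod_morphism.
HB.instance Definition _ := GRing.isMonoidMorphism.Build A (fc_loc A) loc loc_monoid_morphism.

Lemma locZ c a : loc (c *: a) = c *: loc a.
Proof.
rewrite [RHS]loc_scaleE; apply/germP/(germ_pw (fc_idealT A)) => x _.
by rewrite /= scalerAl.
Qed.

(** The product sends x to h(a x) = h(a) x. *)
Lemma germ_loc (h : fc_hom A) a : dom h a -> [h] * loc a = loc (hom h a).
Proof.
move=> ha; have [[_ _ dM] _] := dom_fc h.
rewrite [LHS]loc_mulE; apply/germP/(germ_pw (fc_idealT A)) => x _.
by split=> //=; [split=> //; apply: dM|rewrite homM].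
Qed.

(** The left-hand side is the germ of x |-> sum_i a_i h_i(x), the identity of
[I]: the ideal [I] generates the unit ideal of the localization. *)
Lemma loc_dual_basis (I : set A) m (a : 'I_m -> A) (h : 'I_m -> fc_hom A) :
    fc_ideal I -> (forall i, (I `<=` dom (h i))%classic) ->
    (forall x, I x -> x = \sum_i a i * hom (h i) x) ->
  \sum_i loc (a i) * [h i] = 1.
Proof.
move=> fI Ih aE.
have [g [-> gP]] : exists g, \sum_i loc (a i) * [h i] = [g] /\
    forall x, I x -> dom g x /\ hom g x = \sum_i a i * hom (h i) x.
  elim: (index_enum _) => [|i r [g [gE gP]]].
    exists (fch_zero A); split; first by rewrite big_nil.
    by move=> x _; rewrite big_nil.
  exists (fch_add (fch_mul (fch_lmul (a i)) (h i)) g); split.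
    by rewrite big_cons gE [_ * _]loc_mulE [LHS]loc_addE.
  by move=> x Ix; have [gx gxE] := gP x Ix; rewrite big_cons /= gxE; do !split=> //; apply: Ih.
apply/germP/(germ_pw fI) => x Ix; have [gx ->] := gP x Ix.
by rewrite -aE.
Qed.

(** A map phi on [I] is represented by sum_i phi(a_i) [c_i]. *)
Lemma loc_closing : fc_hereditary A -> fc_closing loc.
Proof.
move=> hA X I phi fI phiP; have [m [a [c [Ia cP aE]]]] := hA I fI.
pose q i : fc_loc A := [FcHom fI (cP i).1 (cP i).2].
exists (\sum_i (q i : (fc_loc A)^c) *: phi (a i)); split=> [x Ix|y yP].
  rewrite {1}(aE x Ix) (hom_on_sum _ fI phiP Ia) /res_act scaler_sumr.
  by apply: eq_bigr => i _; rewrite rscaleA germ_loc.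
have := loc_dual_basis fI (h := fun i => FcHom fI (cP i).1 (cP i).2) (fun i x Ix => Ix) aE.
move=> q1; rewrite -[RHS]scale1r -[1 : (fc_loc A)^c]q1 scaler_suml.
by apply: eq_bigr => i _; rewrite yP // /res_act rscaleA.
Qed.

Section Universal.
Variables (T : pzRingType) (f : {rmorphism A -> T}).
Hypothesis fc : fc_closing f.

Lemma mulr_fc_inj I (x y : T) : fc_ideal I ->
  (forall a, I a -> x * f a = y * f a) -> x = y.
Proof. by move=> fI; apply: (fc_closing_inj fc fI (X := T^c^o)). Qed.

(** The germ of [h] is sent to the element representing f o h on the domain of
[h]; all identities between such elements can be tested on an ideal of finite
codimension. *)
Lemma loc_ext : exists phi : {rmorphism fc_loc A -> T}, phi \o loc =1 f.
Proof.
have /choice[Y YP] h : exists y, forall a, dom h a -> f (hom h a) = y * f a.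
  have [|y [yP _]] := @fc T^c^o _ (f \o hom h) (dom_fc h); last by exists y.
  by split=> [a b ha hb|a r ha] /=; rewrite ?homD ?homM ?rmorphD ?rmorphM.
pose phi (u : fc_loc A) := Y (repr u).
have phiE h : phi [h] = Y h.
  have [I [fI sI eqI]] := germ_repr h.
  by apply: (mulr_fc_inj fI) => a Ia; have [? ?] := sI a Ia; rewrite -!YP // eqI.
have phi_zmod : zmod_morphism phi.
  elim/quotW=> g; elim/quotW=> h.
  rewrite [- _]loc_oppE [_ + _ in LHS]loc_addE !phiE.
  apply: (mulr_fc_inj (fc_idealI (dom_fc g) (dom_fc h))) => a [ga ha].
  by rewrite mulrBl -!YP //= rmorphB.
have phi_monoid : monoid_morphism phi.
  split.
    rewrite [phi _]phiE; apply: (mulr_fc_inj (fc_idealT A)) => a _.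
    by rewrite -YP // mul1r.
  elim/quotW=> g; elim/quotW=> h; rewrite [_ * _ in LHS]loc_mulE !phiE.
  apply: (mulr_fc_inj (dom_fc (fch_mul g h))) => a [ha gha].
  by rewrite -mulrA -!YP.
pose za := GRing.isZmodMorphism.Build _ _ phi phi_zmod.
pose ma := GRing.isMonoidMorphism.Build _ _ phi phi_monoid.
exists (HB.pack_for {rmorphism fc_loc A -> T} phi za ma) => a /=.
rewrite phiE; apply: (mulr_fc_inj (fc_idealT A)) => x _.
by rewrite -YP //= rmorphM.
Qed.

(** The image y of the germ of [h] is forced: [germ_loc] gives y f(a) = f(h(a))
for [a] in the domain of [h]. *)
Lemma loc_ext_uniq (phi psi : {rmorphism fc_loc A -> T}) :
  phi \o loc =1 f -> psi \o loc =1 f -> phi =1 psi.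
Proof.
move=> phiE psiE; elim/quotW=> h; apply: (mulr_fc_inj (dom_fc h)) => a ha.
by rewrite -{1}phiE -psiE /= -!rmorphM germ_loc // [LHS]phiE [RHS]psiE.
Qed.

End Universal.
End Loc.

(** [loc] and [lambda] are both closing and both invert Sigma, so the two
universal properties give maps in both directions; uniqueness makes them inverse.  The
map is k-linear because scaling by c in k is multiplication by [loc c%:A], which
goes to [lambda c%:A]. *)
Theorem fc_loc_universal (k : fieldType) (A : algType k) (Q : algType k)
    (lambda : {lrmorphism A -> Q}) :
    fc_hereditary A -> universal_localization (@Sigma_fc k A) lambda ->
  exists phi : {rmorphism fc_loc A -> Q}, scalable phi /\ bijective phi.
Proof.
move=> hA [lambda_inv univ]; have loc_fc := loc_closing hA.
have lambda_fc := inverting_closing hA lambda_inv.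
have [phi phiE] := loc_ext lambda_fc.
have [[psi psiE] _] := univ _ _ (closing_inverting loc_fc).
exists phi; split=> [c u|].
  have -> : c *: u = loc c%:A * u.
    by rewrite locZ rmorph1 -loc_scaleAl mul1r.
  by rewrite rmorphM [phi (loc _)]phiE /= rmorph_alg mulr_algl.
exists psi.
  apply: (@loc_ext_uniq _ _ _ _ loc_fc (psi \o phi) idfun) => a //=.
  by rewrite [phi _]phiE [LHS]psiE.
have [_ uniq] := univ _ _ lambda_inv.
by apply: (uniq (phi \o psi) idfun) => a //=; rewrite [psi _]psiE [LHS]phiE.
Qed.

(** * Dual bases in free algebras *)

(** A spanning family of least size is a basis of V / W. *)
Lemma finite_codim_basis (k : fieldType) (V : lmodType k) (W : set V) :
    lin_closed W -> finite_codim W ->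
  exists (d : nat) (b : 'I_d -> V),
    (forall v, exists c : 'I_d -> k, W (v - \sum_i c i *: b i)) /\
    (forall c : 'I_d -> k, W (\sum_i c i *: b i) -> forall i, c i = 0).
Proof.
move=> Wl fW; pose spans d := exists b : 'I_d -> V,
  forall v, exists c : 'I_d -> k, W (v - \sum_i c i *: b i).
have exd : exists d, `[< spans d >] by have [d [b bP]] := fW; exists d; apply/asboolP; exists b.
have [d /asboolP[b bP] dmin] := ex_minnP exd.
exists d, b; split=> // c Wc i; apply/eqP/negPn/negP => ci.
(* A relation with a nonzero i-th coefficient makes [b i] superfluous. *)
suff /asboolP/dmin : spans d.-1 by rewrite -ltnS (ltn_predK (ltn_ord i)) ltnn.
exists (b \o lift i) => v; have [x Wx] := bP v.
exists (fun j => x (lift i j) - x i / c i * c (lift i j)).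
have := lin_closedD Wl Wx (lin_closedZ (x i / c i) Wl Wc).
rewrite scaler_sumr -addrA -sumrN -big_split (bigD1_ord i) //=; congr (W (_ + _)).
rewrite scalerA divfK // addNr add0r -sumrN; apply: eq_bigr => j _.
by rewrite scalerA -!scaleNr -scalerDl opprB addrC.
Qed.

Lemma dual_basis_fin (k : fieldType) (A : algType k) (I : set A) (J : finType)
    (a : J -> A) (c : J -> A -> A) :
    (forall j, I (a j)) -> (forall j, hom_on I *%R (c j)) ->
    (forall x, I x -> x = \sum_j a j * c j x) -> dual_basis I.
Proof.
move=> Ia ch cE; exists #|J|, (a \o enum_val), (c \o enum_val); split=> [i|i|x Ix].
- exact: Ia.
- exact: ch.
by rewrite {1}(cE x Ix) (big_enum_val (A := J)).
Qed.

Section WordBasis.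
Variables (k : fieldType) (R : algType k) (J : finType) (word : seq J -> R).

(** Words form a k-basis, linear independence being expressed by the extension
of arbitrary functions on words, and they multiply by concatenation. *)
Definition word_basis : Prop :=
  [/\ word [::] = 1, forall s x, word (rcons s x) = word s * word [:: x],
      forall u, exists c : seq (k * seq J), u = \sum_(p <- c) p.1 *: word p.2
    & forall (V : lmodType k) (F : seq J -> V),
        exists L : {linear R -> V}, forall s, L (word s) = F s].

Hypothesis wordP : word_basis.

Let letter x := word [:: x].

Lemma word_ind (K : R -> Prop) :
  (forall s, K (word s)) ->
  (forall c u v, K u -> K v -> K (c *: u + v)) -> forall u, K u.
Proof.
move=> Kw KD u; have [_ _ span _] := wordP; have [c ->] := span u.
have K0 : K 0 by have := KD (-1) _ _ (Kw [::]) (Kw [::]); rewrite scaleN1r addNr.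
by elim/big_rec: _ => // p v _ Kv; apply: KD.
Qed.

Lemma letter_ind (K : R -> Prop) :
  K 1 -> (forall u x, K u -> K (u * letter x)) ->
  (forall c u v, K u -> K v -> K (c *: u + v)) -> forall u, K u.
Proof.
move=> K1 KM KD; apply: word_ind => // s; have [word0 wordS _ _] := wordP.
by elim/last_ind: s => [|s x IH]; rewrite ?word0 // wordS; apply: KM.
Qed.

(** As words grow at the right end, the two equations define [D] on words by
recursion; the recursion runs over the reversed word. *)
Lemma fox_derivation (e : J -> {linear R -> R}) :
  exists D : {linear R -> R},
    D 1 = 0 /\ forall u x, D (u * letter x) = D u * letter x + e x u.
Proof.
have [word0 wordS _ ext] := wordP.
pose fix G s : R := if s is x :: s' then G s' * letter x + e x (word (rev s')) else 0.
have [D DE] := ext R (G \o rev).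
exists D; split=> [|u x]; first by rewrite -word0 DE.
elim/word_ind: u => [s|c u v IHu IHv].
  by rewrite -wordS !DE /= rev_rcons /= revK.
by rewrite mulrDl -scalerAl !linearP IHu IHv mulrDl -scalerAl scalerDr addrACA.
Qed.

(** The relations [rel i x], the element 1 - sum_i cf_i(1) b_i, the maps [D] and
the identity map form a dual basis of [I].  The maps [D] are right linear on [I]
only, since the coordinates [cf] vanish there. *)
Lemma word_basis_hereditary : fc_hereditary R.
Proof.
move=> I fI; have Il := fc_ideal_lin fI; have [[I0 ID IM] fcI] := fI.
have [d [b [/choice[cf cfP] bfree]]] := finite_codim_basis Il fcI.
have cfu u c : I (u - \sum_i c i *: b i) -> cf u =1 c.
  move=> Ic i; apply/eqP; rewrite -subr_eq0; apply/eqP.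
  apply: (bfree (fun i => cf u i - c i)).
  have := lin_closedB Il Ic (cfP u).
  rewrite opprB addrC subrKA -sumrB.
  by congr I; apply: eq_bigr => j _; rewrite scalerBl.
have cf_lin c u v i : cf (c *: u + v) i = c * cf u i + cf v i.
  apply: (cfu _ (fun i => c * cf u i + cf v i)).
  have := lin_closedD Il (lin_closedZ c Il (cfP u)) (cfP v).
  rewrite scalerBr scaler_sumr addrACA -opprD -big_split /=; congr (I (_ - _)).
  by apply: eq_bigr => j _; rewrite scalerDl scalerA.
have cf0 u i : I u -> cf u i = 0.
  move=> Iu; apply: (cfu u (fun=> 0)).
  by rewrite big1 ?subr0 // => j _; rewrite scale0r.
pose rel i x := b i * letter x - \sum_j cf (b i * letter x) j *: b j.
(* Right multiplication by a letter acts on coordinates by the matrix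
   cf_j(b_i x), up to an error expressed by the relations. *)
have reduce u x : u * letter x -
    \sum_j (\sum_i cf u i * cf (b i * letter x) j) *: b j =
    (u - \sum_i cf u i *: b i) * letter x + \sum_i cf u i *: rel i x.
  under [X in _ = _ + X]eq_bigr do rewrite scalerBr.
  rewrite sumrB mulrBl mulr_suml.
  under [X in _ = _ - X + _]eq_bigr do rewrite -scalerAl.
  rewrite addrA subrK; congr (_ - _).
  under [RHS]eq_bigr do rewrite scaler_sumr.
  rewrite exchange_big; apply: eq_bigr => j _ /=.
  by rewrite scaler_suml; apply: eq_bigr => i _; rewrite scalerA.
have cfM u x j : cf (u * letter x) j = \sum_i cf u i * cf (b i * letter x) j.
  apply: (cfu _ (fun j => \sum_i cf u i * cf (b i * letter x) j)).
  rewrite reduce; apply: ID; first exact: IM.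
  by apply: lin_closed_sum => // i; apply: cfP.
have /choice[D DP] (p : 'I_d * J) : exists D : {linear R -> R}, D 1 = 0 /\
    forall u x, D (u * letter x) = D u * letter x + ((x == p.2)%:R * cf u p.1) *: 1.
  pose e x (u : R) : R := ((x == p.2)%:R * cf u p.1) *: 1.
  have elin x : linear (e x).
    move=> c u v; rewrite /e cf_lin mulrDr scalerDl; congr (_ + _).
    by rewrite mulrCA scalerA.
  have [D DE] := fox_derivation (fun x => HB.pack_for {linear R -> R} (e x)
    (GRing.isLinear.Build _ _ _ _ (e x) (elin x))).
  by exists D.
pose a (j : 'I_1 + 'I_d * J) : R := match j with
  | inl _ => 1 - \sum_i cf 1 i *: b i
  | inr (i, x) => rel i x
  end.
pose c (j : 'I_1 + 'I_d * J) (u : R) : R :=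
  if j is inr p then D p u else u.
apply: (@dual_basis_fin _ _ _ ('I_1 + 'I_d * J)%type a c).
- by case=> [i|[i x]]; apply: cfP.
- case=> [i|p]; first by [].
  rewrite -[c _]/(D p : R -> R); split=> [u v _ _|u r Iu]; first by rewrite linearD.
  elim/letter_ind: r => [|r x IH|s r r' IH IH']; first by rewrite !mulr1.
    rewrite mulrA (DP p).2 IH cf0 ?mulr0 ?scale0r ?addr0 ?mulrA //.
    exact: IM.
  by rewrite !mulrDr linearD IH' -!scalerAr linearZ /= IH.
(* The identity is proved for all u, including the part of u outside [I], so
   that it can be proved letter by letter. *)
suff aE u : u - \sum_i cf u i *: b i = \sum_j a j * c j u.
  move=> u Iu; rewrite -aE big1 ?subr0 // => i _; by rewrite cf0 ?scale0r.
rewrite big_sumType big_ord1 /=.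
elim/letter_ind: u => [|u x IH|s u v IHu IHv].
- rewrite mulr1 [X in _ = _ + X]big1 ?addr0 // => -[i x] _ /=.
  by rewrite (DP _).1 mulr0.
- have -> : u * letter x - \sum_i cf (u * letter x) i *: b i =
    (u - \sum_i cf u i *: b i) * letter x + \sum_i cf u i *: a (inr (i, x)).
    by rewrite -reduce; congr (_ - _); apply: eq_bigr => j _; rewrite cfM.
  rewrite IH mulrDl mulrA -addrA; congr (_ + _).
  under [RHS]eq_bigr do rewrite (DP _).2 mulrDr mulrA.
  rewrite big_split /= -mulr_suml; congr (_ + _).
  transitivity (\sum_i \sum_y rel i y * ((x == y)%:R * cf u i)%:A); last first.
    by rewrite pair_bigA; apply: eq_bigr => -[].
  apply: eq_bigr => i _; rewrite (bigD1 x) //= big1 => [|y /negPf yx].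
    by rewrite eqxx mul1r -scalerAr mulr1 addr0.
  by rewrite eq_sym yx mul0r scale0r mulr0.
rewrite mulrDr -scalerAr.
under [X in _ = _ + X]eq_bigr do rewrite linearD linearZ /= mulrDr -scalerAr.
rewrite big_split /= -scaler_sumr addrACA -scalerDr -IHu -IHv.
rewrite scalerBr addrACA -opprD; congr (_ - _).
rewrite scaler_sumr -big_split; apply: eq_bigr => i _ /=.
by rewrite cf_lin scalerDl scalerA.
Qed.

End WordBasis.

Section FreeAlgebra.
Variables (k : fieldType) (n : nat).
Local Notation R := (free_alg k n).

Definition word (s : seq 'I_n.+1) : R := << FMonom s >>.

Lemma word_rcons s x : word (rcons s x) = word s * word [:: x].
Proof.
rewrite /word [RHS]malgM_def fgmulUU mul1r; congr (<< _ >>).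
by apply/val_inj; rewrite /= fmM cats1.
Qed.

Lemma word_nil : word [::] = 1.
Proof. by congr (<< _ >>); apply/val_inj; rewrite /= fm1. Qed.

Lemma free_alg_wordE (u : R) :
  u = \sum_(m <- msupp u) mcoeff m u *: word m :> R.
Proof.
rewrite [LHS]monalgE; apply: eq_bigr => m _; apply/malgP => m'.
by rewrite /word fmK mcoeffU mcoeffZ mcoeffU1 mulr_natr.
Qed.

Lemma word_linear_ext (V : lmodType k) (F : seq 'I_n.+1 -> V) :
  exists L : {linear R -> V}, forall s, L (word s) = F s.
Proof.
pose L (u : R) : V := \sum_(m <- msupp u) mcoeff m u *: F m.
have LE (D : {fset {fmonom 'I_n.+1}}) (u : R) : fsubset (msupp u) D ->
    L u = \sum_(m <- D) mcoeff m u *: F m.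
  move=> uD; apply: big_fset_incl => // m _ /mcoeff_outdom ->.
  by rewrite scale0r.
have Llin : linear L.
  move=> c u v; pose D := fsetU (msupp u) (msupp v).
  rewrite (LE D u) ?(LE D v) ?fsubsetUl ?fsubsetUr //.
  rewrite (LE D); last first.
    apply: fsubset_trans (msuppD_le _ _) _; apply: fsetSU; exact: msuppZ_le.
  rewrite scaler_sumr -big_split; apply: eq_bigr => m _.
  by rewrite mcoeffD mcoeffZ scalerDl scalerA.
pose mL := GRing.isLinear.Build _ _ _ _ L Llin.
exists (HB.pack_for {linear R -> V} L mL) => s /=.
by rewrite /L msuppU1 big_seq_fset1 mcoeffU1 eqxx scale1r.
Qed.

Lemma free_alg_word_basis : word_basis word.
Proof.
split; [exact: word_nil|exact: word_rcons| |exact: word_linear_ext] => u.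
exists [seq (mcoeff m u, m : seq _) | m <- msupp u].
by rewrite big_map [LHS]free_alg_wordE.
Qed.

End FreeAlgebra.

Theorem theorem6p4 (k : fieldType) (n : nat) (n_gt0 : (0 < n)%N)
    (Q : algType k) (lambda : {lrmorphism free_alg k n -> Q})
    (Q_univ : universal_localization (@Sigma_fc k (free_alg k n)) lambda) :
  exists phi : {lrmorphism fc_loc (free_alg k n) -> Q}, bijective phi.
Proof.
have hA := word_basis_hereditary (@free_alg_word_basis k n).
have [phi [phiZ phi_bij]] := fc_loc_universal hA Q_univ.
pose phi_scal := GRing.isScalable.Build k (fc_loc (free_alg k n)) Q *:%R phi phiZ.
by exists (HB.pack_for {lrmorphism fc_loc (free_alg k n) -> Q}
  (phi : fc_loc (free_alg k n) -> Q) phi phi_scal).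
Qed.
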